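(* Let $R$ be a ring such that every idempotent lifts modulo $\delta(R)$. If $R$ is $\delta$-reversible, then $R/\delta(R)$ is an abelian ring.
   Context: All rings are associative with identity. A submodule $N$ of a right module $M$ is $\delta$-small in $M$ if whenever $M=N+L$ with $M/L$ singular, then $M=L$. The Zhou radical $\delta(R)$ is the sum of all $\delta$-small right ideals of $R$; equivalently, $\delta(R)$ is the intersection of all essential maximal right ideals of $R$ (with $\delta(R)=R$ if there are none). It is a two-sided ideal of $R$. A ring $R$ is $\delta$-reversible if for all $a,b\in R$, $ab=0$ implies $ba\in\delta(R)$. Idempotents lift modulo $\delta(R)$ if for every $f\in R$ with $f^2-f\in\delta(R)$ there exists $e^2=e\in R$ with $e-f\in\delta(R)$. A ring is abelian if all its idempotents are central. *)

(* Defs.v *)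
From HB Require Import structures.
From mathcomp Require Import all_boot all_algebra.
From mathcomp Require Import boolp.

Set Implicit Arguments.
Unset Strict Implicit.
Unset Printing Implicit Defensive.

Import GRing.Theory.
Local Open Scope ring_scope.
Local Open Scope quotient_scope.

(* Modules are lmodType A for an arbitrary ring A, so right R-modules are
   lmodType R^c, where R^c is the opposite ring. In particular (R^c)^o is R as a
   right module over itself: r *: x is the product x * r of R.
   Rings are pzRingType, hence possibly zero; this matters for the quotient
   by delta R, which can be all of R. *)

Section QuotientModule.
Variables (A : pzRingType) (M : lmodType A) (L : submodClosed M).

(* submodClosed does not inherit from zmodClosed, which Quotient.quot expects;
   submod_pred is the copy of L that carries the latter structure *)
Definition submod_pred : {pred M} := L.

Fact submod_zmod_closed : zmod_closed submod_pred.
Proof. exact: GRing.submod_closedB (GRing.submodClosedP L). Qed.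

HB.instance Definition _ :=
  GRing.isZmodClosed.Build M submod_pred submod_zmod_closed.

Definition quot_mod : Type := Quotient.quot submod_pred.

HB.instance Definition _ := GRing.Zmodule.on quot_mod.
HB.instance Definition _ := EqQuotient.on quot_mod.

Definition quot_scale (a : A) (x : quot_mod) : quot_mod :=
  \pi_quot_mod (a *: repr x).

Lemma pi_quot_modD (x y : M) :
  \pi_quot_mod (x + y) = \pi_quot_mod x + \pi_quot_mod y.
Proof. exact: (raddfD (\pi_(Quotient.quot submod_pred))). Qed.

Lemma pi_quot_mod_eq (x y : M) :
  \pi_quot_mod x = \pi_quot_mod y <-> x - y \in L.
Proof.
rewrite [x - y \in L](Quotient.idealrBE submod_pred).
by split=> /eqP.
Qed.

Lemma pi_quot_scale a x : quot_scale a (\pi_quot_mod x) = \pi_quot_mod (a *: x).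
Proof.
apply/pi_quot_mod_eq; rewrite -scalerBr rpredZ //.
by apply/pi_quot_mod_eq; rewrite reprK.
Qed.

Lemma quot_scaleA a b x : quot_scale a (quot_scale b x) = quot_scale (a * b) x.
Proof.
by elim/quotW: x => x; rewrite (pi_quot_scale b) !pi_quot_scale scalerA.
Qed.

Lemma quot_scale1 : left_id 1 quot_scale.
Proof. by elim/quotW=> x; rewrite pi_quot_scale scale1r. Qed.

Lemma quot_scaleDr : right_distributive quot_scale +%R.
Proof.
move=> a; elim/quotW=> x; elim/quotW=> y.
by rewrite -pi_quot_modD !pi_quot_scale scalerDr pi_quot_modD.
Qed.

Lemma quot_scaleDl x : {morph quot_scale^~ x : a b / a + b}.
Proof.
by elim/quotW: x => x a b; rewrite !pi_quot_scale scalerDl pi_quot_modD.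
Qed.

HB.instance Definition _ := GRing.Zmodule_isLmodule.Build A quot_mod
  quot_scaleA quot_scale1 quot_scaleDr quot_scaleDl.

End QuotientModule.

Section Singular.
Variable A : pzRingType.

Definition essential (M : lmodType A) (E : submodClosed M) : Prop :=
  forall N : submodClosed M, (forall x, x \in E -> x \in N -> x = 0) ->
  forall x, x \in N -> x = 0.

Definition ann (M : lmodType A) (m : M) : {pred A^o} :=
  [pred a : A^o | (a : A) *: m == 0].

Section Annihilator.
Variables (M : lmodType A) (m : M).

Lemma ann_submod_closed : submod_closed (ann m).
Proof.
split=> [|a x y]; rewrite !inE ?scale0r // => /eqP xm /eqP ym.
by rewrite scalerDl ym addr0 -scalerA xm scaler0.
Qed.

HB.instance Definition _ :=
  GRing.isSubmodClosed.Build A A^o (ann m) ann_submod_closed.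

End Annihilator.

Definition singular (M : lmodType A) : Prop := forall m : M, essential (ann m).

Definition delta_small (M : lmodType A) (N : submodClosed M) : Prop :=
  forall L : submodClosed M,
    (forall m, exists2 n, n \in N & exists2 l, l \in L & m = n + l) ->
    singular (quot_mod L) ->
  forall m, m \in L.

End Singular.

HB.mixin Record isMulAbsorbing (R : pzRingType) (S : {pred R}) := {
  ideal_mull : forall a x, x \in S -> a * x \in S;
  ideal_mulr : forall a x, x \in S -> x * a \in S
}.

#[short(type="ideal2")]
HB.structure Definition Ideal2 (R : pzRingType) :=
  {S of GRing.ZmodClosed R S & isMulAbsorbing R S}.

Section QuotientRing.
Variables (R : pzRingType) (I : ideal2 R).

Definition quot_ring : Type := Quotient.quot I.

HB.instance Definition _ := GRing.Zmodule.on quot_ring.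
HB.instance Definition _ := EqQuotient.on quot_ring.

Definition quot_one : quot_ring := \pi_quot_ring 1.
Definition quot_mul (x y : quot_ring) : quot_ring :=
  \pi_quot_ring (repr x * repr y).

Lemma pi_quot_ringD (x y : R) :
  \pi_quot_ring (x + y) = \pi_quot_ring x + \pi_quot_ring y.
Proof. exact: (raddfD (\pi_(Quotient.quot I))). Qed.

Lemma pi_quot_ring_eq (x y : R) :
  \pi_quot_ring x = \pi_quot_ring y <-> x - y \in I.
Proof. by rewrite Quotient.idealrBE; split=> /eqP. Qed.

Lemma pi_quot_mul x y :
  quot_mul (\pi_quot_ring x) (\pi_quot_ring y) = \pi_quot_ring (x * y).
Proof.
apply/pi_quot_ring_eq; set x' := repr _; set y' := repr _.
have -> : x' * y' - x * y = (x' - x) * y' + x * (y' - y).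
  by rewrite mulrBl mulrBr addrA subrK.
by apply: rpredD; [apply: ideal_mulr | apply: ideal_mull];
  apply/pi_quot_ring_eq; rewrite reprK.
Qed.

Lemma quot_mulA : associative quot_mul.
Proof.
elim/quotW=> x; elim/quotW=> y; elim/quotW=> z.
by rewrite (pi_quot_mul x y) (pi_quot_mul y z) !pi_quot_mul mulrA.
Qed.

Lemma quot_mul1r : left_id quot_one quot_mul.
Proof. by elim/quotW=> x; rewrite pi_quot_mul mul1r. Qed.

Lemma quot_mulr1 : right_id quot_one quot_mul.
Proof. by elim/quotW=> x; rewrite pi_quot_mul mulr1. Qed.

Lemma quot_mulDl : left_distributive quot_mul +%R.
Proof.
elim/quotW=> x; elim/quotW=> y; elim/quotW=> z.
by rewrite -pi_quot_ringD !pi_quot_mul mulrDl pi_quot_ringD.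
Qed.

Lemma quot_mulDr : right_distributive quot_mul +%R.
Proof.
elim/quotW=> x; elim/quotW=> y; elim/quotW=> z.
by rewrite -pi_quot_ringD !pi_quot_mul mulrDr pi_quot_ringD.
Qed.

HB.instance Definition _ := GRing.Zmodule_isPzRing.Build quot_ring
  quot_mulA quot_mul1r quot_mulr1 quot_mulDl quot_mulDr.

End QuotientRing.

Notation right_ideal R := (submodClosed (R^c)^o).

(* The sum of the family of all delta-small right ideals consists of the finite
   sums of elements taken from members of the family. *)
Definition delta (R : pzRingType) : {pred R} := fun x =>
  `[< exists2 s : seq R,
        forall y, y \in s -> exists2 N : right_ideal R, delta_small N & y \in N
      & x = \sum_(y <- s) y >].

Section DeltaIdeal.
Variable R : pzRingType.

Section LeftTranslate.
Variables (a : R) (N L : right_ideal R).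

Definition ltrans : {pred (R^c)^o} := fun x : R =>
  `[< exists2 y : R, y \in N & x = a * y >].

Lemma ltrans_submod_closed : submod_closed ltrans.
Proof.
have [N0 Nlin] := GRing.submodClosedP N.
split=> [|b x y /asboolP[u Nu ->] /asboolP[v Nv ->]]; apply/asboolP.
  by exists 0; rewrite ?mulr0.
exists (u * b + v); last by rewrite mulrDr mulrA.
exact: (Nlin b _ _ Nu Nv).
Qed.

HB.instance Definition _ :=
  GRing.isSubmodClosed.Build R^c (R^c)^o ltrans ltrans_submod_closed.

Definition lpreim : {pred (R^c)^o} := fun x : R => (a * x : R) \in L.

Lemma lpreim_submod_closed : submod_closed lpreim.
Proof.
have [L0 Llin] := GRing.submodClosedP L.
split=> [|b x y]; rewrite !unfold_in /lpreim ?mulr0 // => Lx Ly.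
change ((a * ((x : R) * (b : R) + y) : R) \in L).
by rewrite mulrDr mulrA; apply: (Llin b).
Qed.

HB.instance Definition _ :=
  GRing.isSubmodClosed.Build R^c (R^c)^o lpreim lpreim_submod_closed.

End LeftTranslate.

Lemma ann_quotE (L : right_ideal R) (m r : R) :
  ((r : (R^c)^o) \in ann (\pi_(quot_mod L) (m : (R^c)^o))) =
  ((m * r : R) \in L).
Proof.
rewrite inE [_ *: _]pi_quot_scale -[0](raddf0 (\pi_(Quotient.quot _))).
by apply/eqP/idP; rewrite pi_quot_mod_eq subr0.
Qed.

Lemma eq_essential (A : pzRingType) (M : lmodType A) (E E' : submodClosed M) :
  E =i E' -> essential E -> essential E'.
Proof. by move=> eqE essE N NE; apply: essE => x; rewrite eqE; apply: NE. Qed.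

Lemma ltrans_delta_small a (N : right_ideal R) :
  delta_small N -> delta_small (ltrans a N).
Proof.
move=> smallN L sumL singL m.
have aL (x : R) : (a * x : R) \in L.
  apply: (smallN (lpreim a L)) => [{}m|].
    have [n /asboolP[y Ny ->] [l Ll aml]] := sumL (a * m : R).
    exists y => //; exists (m - y); last by rewrite addrC subrK.
    by rewrite unfold_in /lpreim mulrBr aml addrC addKr.
  elim/quotW=> {}m; apply: eq_essential (singL (\pi_(quot_mod L) (a * m : R))).
  by move=> r; rewrite !ann_quotE [RHS]unfold_in /lpreim mulrA.
have [n /asboolP[y _ ->] [l Ll ->]] := sumL m.
exact: (rpredD (aL y)).
Qed.

Lemma delta_zmod_closed : zmod_closed (@delta R).
Proof.
split=> [|x y /asboolP[s sN ->] /asboolP[t tN ->]]; apply/asboolP.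
  by exists [::]; rewrite ?big_nil.
exists (s ++ map -%R t); last by rewrite big_cat big_map sumrN.
move=> z; rewrite mem_cat => /orP[/sN //|/mapP[u /tN[N smallN Nu] ->]].
by exists N => //; apply: (GRing.zmod_closedN (submod_zmod_closed N)).
Qed.

Lemma delta_mull (a x : R) : x \in @delta R -> a * x \in @delta R.
Proof.
move=> /asboolP[s sN ->]; apply/asboolP; exists (map ( *%R a) s).
  move=> _ /mapP[u /sN[N smallN Nu] ->].
    apply: (ex_intro2 _ _ _ (ltrans_delta_small (a := a) smallN)).
  by apply/asboolP; exists u.
by rewrite big_map mulr_sumr.
Qed.

Lemma delta_mulr (a x : R) : x \in @delta R -> x * a \in @delta R.
Proof.
move=> /asboolP[s sN ->]; apply/asboolP; exists (map ( *%R^~ a) s).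
  move=> _ /mapP[u /sN[N smallN Nu] ->]; exists N => //.
  exact: (@rpredZ R^c (R^c)^o N a u Nu).
by rewrite big_map mulr_suml.
Qed.

HB.instance Definition _ :=
  GRing.isZmodClosed.Build R (@delta R) delta_zmod_closed.
HB.instance Definition _ :=
  isMulAbsorbing.Build R (@delta R) delta_mull delta_mulr.

End DeltaIdeal.

Arguments delta R : clear implicits.

Definition delta_reversible (R : pzRingType) : Prop :=
  forall a b : R, a * b = 0 -> b * a \in delta R.

Definition idempotents_lift (R : pzRingType) (I : {pred R}) : Prop :=
  forall f : R, f * f - f \in I -> exists2 e : R, e * e = e & e - f \in I.

Definition abelian_ring (R : pzRingType) : Prop :=
  forall e : R, e * e = e -> forall x : R, e * x = x * e.

(* Main.v *)
Require Import Defs.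
From mathcomp Require Import all_boot all_algebra.

Import GRing.Theory.
Local Open Scope ring_scope.
Local Open Scope quotient_scope.

(** For an idempotent [e] of [R], the commutator with [r] is the difference of the Peirce corners
    [e * r * (1 - e)] and [(1 - e) * r * e]. Lifting reduces the quotient to this case. *)

Lemma delta_reversible_idem_comm (R : pzRingType) (e r : R) :
  delta_reversible R -> e * e = e -> e * r - r * e \in delta R.
Proof.
move=> hrev ee.
have -> : e * r - r * e = e * r * (1 - e) - (1 - e) * r * e.
  by rewrite mulrBr mulr1 !mulrBl mul1r opprB addrA subrK.
(* Swapped, the corners become [(1 - e) * (e * r)] and [(r * e) * (1 - e)], both zero. *)
apply: rpredB; first by apply: hrev; rewrite mulrA mulrBl mul1r ee subrr mul0r.
by rewrite -mulrA; apply: hrev; rewrite -mulrA mulrBr mulr1 ee subrr mulr0.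
Qed.

Theorem proposition2p8 (R : pzRingType)
    (hlift : idempotents_lift (delta R)) (hrev : delta_reversible R) :
  abelian_ring (quot_ring (delta R)).
Proof.
elim/quotW=> f; rewrite [_ * _]pi_quot_mul => /pi_quot_ring_eq /hlift[e ee ef].
(* Represent the class of [f] by the true idempotent [e]. *)
have <- : \pi_(quot_ring (delta R)) e = \pi f by apply/pi_quot_ring_eq.
elim/quotW=> r; rewrite [LHS]pi_quot_mul [RHS]pi_quot_mul.
exact/pi_quot_ring_eq/delta_reversible_idem_comm.
Qed.
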